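(* Let $\mathcal L$ be a complex simple Lie algebra of type $A_n$ ($n\ge3$), $D_n$ ($n\ge4$) or $E_n$ ($n\in\{6,7,8\}$), and let $(\mathfrak A,\ast,\mathcal B)$, $\theta\colon\mathfrak A\to\mathcal A$ and $C_{\mathcal L}\in\mathcal A$ be as in the context. Then $\mathbf 1:=\theta^{-1}(C_{\mathcal L})$ is a unit for the algebra $(\mathfrak A,\ast)$, i.e. $\mathbf 1\ast a=a\ast\mathbf 1=a$ for all $a\in\mathfrak A$.
   Context: Let $\mathcal H$ be a Cartan subalgebra, $\Phi$ the roots, $h_\alpha$ the coroots, $e_\alpha$ root vectors of a Chevalley basis, $\omega$ the highest root, and $\kappa$ the rescaled Killing form with $\kappa(h_\alpha,h_\alpha)=2$; identify $\mathcal H^*=\mathcal H$ via $\kappa$. On the $\mathcal L$-module $S^2(\mathcal L)$ put $$\ell_1\ell_2\bullet\ell_3\ell_4=\tfrac14(\kappa(\ell_1,\ell_3)\ell_2\ell_4+\kappa(\ell_1,\ell_4)\ell_2\ell_3+\kappa(\ell_2,\ell_3)\ell_1\ell_4+\kappa(\ell_2,\ell_4)\ell_1\ell_3),$$ $$B(\ell_1\ell_2,\ell_3\ell_4)=\tfrac12(\kappa(\ell_1,\ell_3)\kappa(\ell_2,\ell_4)+\kappa(\ell_1,\ell_4)\kappa(\ell_2,\ell_3)).$$ Let $\mathcal A$ be the $B$-orthogonal complement of the submodule generated by $e_\omega e_\omega$, $v\mapsto\overline v$ the orthogonal projection onto $\mathcal A$, $a\ast b=\overline{a\bullet b}$ for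 $a,b\in\mathcal A$, and $\mathcal B=B|_{\mathcal A\times\mathcal A}$. Let $C_{\mathcal L}=\sum_ib_ib_i^*\in S^2(\mathcal L)$, where $(b_i)$ is a basis of $\mathcal L$ and $(b_i^* )$ its $\kappa$-dual basis; it lies in $\mathcal A$. Let $\Lambda_0=\{\alpha+\beta\mid\alpha,\beta\in\Phi,\ \kappa(\alpha,\beta)=0\}$ and for $\lambda\in\Lambda_0$ fix $\alpha_\lambda,\beta_\lambda\in\Phi$ with $\alpha_\lambda+\beta_\lambda=\lambda$. The vector space $\mathfrak A$ is the direct sum of $\mathfrak J=\langle j_\alpha\mid\alpha\in\Phi\rangle\subseteq\mathrm{End}(\mathcal H)$, where $j_\alpha(h)=\kappa(h,h_\alpha)h_\alpha$; of copies $\mathfrak H_\alpha$ of $\alpha^\perp\subset\mathcal H$ for $\alpha\in\Phi$ (with $[h]_\alpha$ the orthogonal projection of $h\in\mathcal H$ to $\mathfrak H_\alpha$); and of a space with basis $\{x_\lambda\mid\lambda\in\Lambda_0\}$. The map $\theta\colon\mathfrak A\to\mathcal A$ is the linear isomorphism with $j_\alpha\mapsto\overline{h_\alpha h_\alpha}$, $[h]_\alpha\mapsto\overline{e_\alpha h}$, $x_\lambda\mapsto\overline{e_{\alpha_\lambda}e_{\beta_\lambda}}$. The product and form on $\mathfrak A$ are those for which $\theta$ is an isomorphism onto $(\mathcal A,\ast,\mathcal B)$. *)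

(* Defs.v *)
From HB Require Import structures.
From mathcomp Require Import all_boot all_order all_algebra finmap.
From mathcomp Require Import reals complex ring.
Set Implicit Arguments.
Unset Strict Implicit.
Unset Printing Implicit Defensive.
Import Order.TTheory GRing.Theory Num.Theory.
Import passmx.
Local Open Scope ring_scope.

HB.mixin Record isLieAlgebra (K : fieldType) L of Vector K L := {
  lie : L -> L -> L;
  lieDZr : forall (x : L) (a : K) (y z : L),
    lie x (a *: y + z) = a *: lie x y + lie x z;
  liexx : forall x : L, lie x x = 0;
  lie_jacobi : forall x y z : L,
    lie x (lie y z) + lie y (lie z x) + lie z (lie x y) = 0;
  lieDZl : forall (x : L) (a : K) (y z : L),
    lie (a *: y + z) x = a *: lie y x + lie z x
}.

#[short(type="lieAlgType")]
HB.structure Definition LieAlgebra (K : fieldType) :=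
  {L of isLieAlgebra K L & Vector K L}.

Section LieTheory.
Variables (K : fieldType) (L : lieAlgType K).
Implicit Types (x y z : L) (U V I H : {vspace L}).

HB.instance Definition _ x :=
  GRing.isLinear.Build K L L _ (lie x) (lieDZr x).

Definition ad x : 'End(L) := linfun (lie x).

Lemma adE x y : ad x y = lie x y. Proof. by rewrite lfunE. Qed.

Lemma ad_is_linear : linear ad.
Proof.
move=> a x y; apply/lfunP => z.
by rewrite add_lfunE scale_lfunE !adE lieDZl.
Qed.
HB.instance Definition _ := GRing.isLinear.Build K L 'End(L) _ ad ad_is_linear.

Lemma lieC x y : lie x y = - lie y x.
Proof.
have := liexx (x + y).
rewrite -adE [ad _]linearD add_lfunE !linearD /= !adE !liexx add0r addr0.
by move/eqP; rewrite addr_eq0 => /eqP.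
Qed.

Definition is_ideal I := forall x y, y \in I -> lie x y \in I.

Definition is_simple :=
  (exists x y, lie x y != 0) /\
  (forall I, is_ideal I -> I = 0%VS \/ I = fullv).

Definition liev U V : {vspace L} :=
  <<[seq lie u v | u <- vbasis U, v <- vbasis V]>>%VS.

Definition is_nilpotent H :=
  (liev H H <= H)%VS /\ exists k, iter k (liev H) H = 0%VS.

Definition is_cartan H :=
  is_nilpotent H /\
  (forall x, (forall y, y \in H -> lie x y \in H) -> x \in H).

Definition killing x y : K :=
  \tr (mxof (vbasis {:L}) (vbasis {:L}) (ad x \o ad y)%VF).

Definition kappa (c : K) x y : K := c * killing x y.

Lemma killingC x y : killing x y = killing y x.
Proof. by rewrite /killing !(mxof_comp _ _ (vbasisP fullv)) mxtrace_mulC. Qed.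

Lemma killing_is_linear x : linear (killing x : L -> K^o).
Proof.
move=> a y z; rewrite /killing linearP /=.
rewrite comp_lfunDr -comp_lfunZr.
by rewrite linearP /= mxtraceD mxtraceZ.
Qed.

Lemma kappaC c x y : kappa c x y = kappa c y x.
Proof. by rewrite /kappa killingC. Qed.

Lemma kappa_is_linear c x : linear (kappa c x : L -> K^o).
Proof.
move=> a y z; rewrite /kappa killing_is_linear mulrDr.
by congr (_ + _); rewrite /GRing.scale /= mulrCA.
Qed.

End LieTheory.
Arguments is_simple {K} L.

Section Orthogonal.
Variable K : fieldType.

Lemma linfunE (U W : vectType K) (f : U -> W) :
  linear f -> forall u, linfun f u = f u.
Proof.
move=> lf u; pose g : {linear U -> W} :=
  HB.pack f (GRing.isLinear.Build K U W _ f lf).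
exact: (lfunE g u).
Qed.

Variables (V : vectType K) (f : V -> V -> K).

(* f is meant to be symmetric and bilinear. *)
Definition orthv (U : {vspace V}) : {vspace V} :=
  (\bigcap_(i < \dim U) lker (linfun (f (vbasis U)`_i : V -> K^o)))%VS.

(* addv_pi2 (orthv U) U projects onto U along a complement of U :&: orthv U   *)
(* in orthv U. Whenever U and its orthogonal are in direct sum, it is thus    *)
(* the orthogonal projection onto U.                                          *)
Definition orthproj (U : {vspace V}) : 'End(V) := addv_pi2 (orthv U) U.

Hypothesis fC : forall u v, f u v = f v u.
Hypothesis f_lin : forall u, linear (f u : V -> K^o).

Lemma orthvP (U : {vspace V}) v :
  reflect (forall u, u \in U -> f u v = 0) (v \in orthv U).
Proof.
apply: (iffP subv_bigcapP) => [vU u uU | vU i _].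
  rewrite fC -(linfunE (f_lin v)) (coord_vbasis uU) linear_sum big1 // => i _.
  rewrite linearZ /= linfunE // fC.
  suff -> : f (vbasis U)`_i v = 0 by rewrite scaler0.
  by apply/eqP; move: (vU i isT); rewrite -memvE memv_ker linfunE.
rewrite -memvE memv_ker linfunE //; apply/eqP/vU.
by rewrite vbasis_mem // mem_nth // size_tuple.
Qed.
End Orthogonal.

Section SymmetricSquare.
Variables (K : numFieldType) (V : vectType K).

Local Notation b := (vbasis {:V}).
Let b_basis : basis_of {:V} b := vbasisP fullv.

(* V (x) V is represented by square matrices of coordinates, and S^2(V) by    *)
(* the symmetric ones, which is legitimate in characteristic 0.               *)
Definition symtens : {vspace 'M[K]_(\dim {:V})} := fixedSpace (linfun trmx).
Local Notation S2 := (subvs_of symtens).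

Definition tens (u v : V) : 'M[K]_(\dim {:V}) := (rVof b u)^T *m rVof b v.
Definition smul (u v : V) : S2 :=
  vsproj symtens (2^-1 *: (tens u v + tens v u)).

(* The linear map S^2(V) -> W induced by a symmetric bilinear f. *)
Definition sext (W : lmodType K) (f : V -> V -> W) (X : S2) : W :=
  \sum_i \sum_j vsval X i j *: f b`_i b`_j.

Lemma sext_is_linear (W : lmodType K) (f : V -> V -> W) : linear (@sext W f).
Proof.
move=> a X Y; rewrite /sext scaler_sumr -big_split; apply: eq_bigr => i _.
rewrite scaler_sumr -big_split; apply: eq_bigr => j _ /=.
by rewrite !mxE scalerDl scalerA.
Qed.
HB.instance Definition _ (W : lmodType K) (f : V -> V -> W) :=
  GRing.isLinear.Build K S2 W _ (@sext W f) (@sext_is_linear W f).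

Lemma smulC u v : smul u v = smul v u.
Proof. by rewrite /smul addrC. Qed.

Lemma val_smul u v : vsval (smul u v) = 2^-1 *: (tens u v + tens v u).
Proof.
rewrite vsprojK //; apply/fixedSpaceP; rewrite lfunE /= linearZ linearD /=.
by rewrite /tens !trmx_mul !trmxK addrC.
Qed.

Lemma smul_is_linear u : linear (smul u).
Proof.
move=> a v w; apply: val_inj => /=; rewrite !val_smul /tens.
rewrite [rVof b (_ + _)]linearP [(_ + _)^T]linearP /= mulmxDr mulmxDl.
rewrite -scalemxAr -scalemxAl addrACA [LHS]scalerDr -(scalerDr a).
by rewrite !scalerA (mulrC a).
Qed.

Lemma eq_sext (W : lmodType K) (f g : V -> V -> W) X :
  (forall u v, f u v = g u v) -> sext f X = sext g X.
Proof.
by move=> fg; apply: eq_bigr => i _; apply: eq_bigr => j _; rewrite fg.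
Qed.

Lemma sext_smul (W : lmodType K) (f : V -> V -> W) :
    (forall u, linear (f u)) -> (forall u v, f u v = f v u) ->
  forall u v, sext f (smul u v) = f u v.
Proof.
move=> lf fC u v.
have b_sum w : w = \sum_i rVof b w 0 i *: b`_i.
  exact: esym (rVofK b_basis w).
pose F w : {linear V -> W} := HB.pack (f w)
  (GRing.isLinear.Build K V W _ (f w) (lf w)).
have fsum w (c : 'I_(\dim {:V}) -> K) :
    f w (\sum_i c i *: b`_i) = \sum_i c i *: f w b`_i.
  rewrite -[LHS]/(F w _) linear_sum; apply: eq_bigr => i _.
  by rewrite linearZ.
have fuv x y : f x y = \sum_i \sum_j (rVof b x 0 i * rVof b y 0 j) *: f b`_i b`_j.
  rewrite fC {1}(b_sum x) fsum; apply: eq_bigr => i _.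
  rewrite fC {1}(b_sum y) fsum scaler_sumr; apply: eq_bigr => j _.
  by rewrite scalerA.
have tE x y i j : tens x y i j = rVof b x 0 i * rVof b y 0 j.
  by rewrite mxE big_ord1 !mxE.
transitivity (2^-1 *: (f u v + f v u)); last first.
  rewrite (fC v) -[f u v]scale1r -scalerDl scalerA.
  by rewrite -mulr2n mulVf ?pnatr_eq0.
rewrite (fuv u v) (fuv v u) -big_split scaler_sumr; apply: eq_bigr => i _.
rewrite -big_split scaler_sumr; apply: eq_bigr => j _ /=.
by rewrite val_smul 2!mxE !tE -scalerDl scalerA.
Qed.
End SymmetricSquare.

Notation S2 V := (subvs_of (symtens V)).

Section LieSymmetricSquare.
Variables (K : numFieldType) (L : lieAlgType K).
Implicit Types (x y : L) (X Y : S2 L) (W : {vspace S2 L}).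

Definition s2act x : 'End(S2 L) :=
  linfun (sext (fun l1 l2 => smul (lie x l1) l2 + smul l1 (lie x l2))).

Definition s2submodule W := forall x X, X \in W -> s2act x X \in W.

(* Saturation of <[X]> under the action; see the s2gen_* lemmas. *)
Definition s2gen X : {vspace S2 L} :=
  iter (\dim {:S2 L})
    (fun W => (W + \sum_(i < \dim {:L}) (s2act (vbasis {:L})`_i @: W))%VS) <[X]>%VS.

Definition casimir (b bd : (\dim {:L}).-tuple L) : S2 L :=
  \sum_i smul (tnth b i) (tnth bd i).

Variable k : L -> L -> K.

Definition s2bullet X Y : S2 L :=
  sext (fun l1 l2 =>
    sext (fun l3 l4 =>
      4^-1 *: (k l1 l3 *: smul l2 l4 + k l1 l4 *: smul l2 l3 +
               k l2 l3 *: smul l1 l4 + k l2 l4 *: smul l1 l3)) Y) X.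

Definition s2form X Y : K :=
  sext (fun l1 l2 =>
    sext (fun l3 l4 =>
      (2^-1 * (k l1 l3 * k l2 l4 + k l1 l4 * k l2 l3) : K^o)) Y) X.

Lemma s2actE x l1 l2 :
  s2act x (smul l1 l2) = smul (lie x l1) l2 + smul l1 (lie x l2).
Proof.
rewrite lfunE /= sext_smul // => [u a v w|u v].
  by rewrite linearP !smul_is_linear scalerDr addrACA.
by rewrite addrC smulC [smul v _]smulC.
Qed.

Lemma s2act_is_linear : linear s2act.
Proof.
move=> a x y; apply/lfunP => X; rewrite add_lfunE scale_lfunE !lfunE /=.
rewrite /sext scaler_sumr -big_split; apply: eq_bigr => i _ /=.
rewrite scaler_sumr -big_split; apply: eq_bigr => j _ /=.
rewrite scalerA mulrC -scalerA -scalerDr; congr (_ *: _).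
rewrite !lieDZl smulC !smul_is_linear scalerDr !(smulC (vbasis _)`_j).
by rewrite addrACA.
Qed.
HB.instance Definition _ :=
  GRing.isLinear.Build K L 'End(S2 L) _ s2act s2act_is_linear.

Lemma s2gen_submodule X : s2submodule (s2gen X).
Proof.
rewrite /s2gen; set step := fun W => _.
have stepS W : (W <= step W)%VS by exact: addvSl.
have stab n : step (iter n step <[X]>%VS) = iter n step <[X]>%VS \/
              (n <= \dim (iter n step <[X]>%VS))%N.
  elim: n => [|n [IH|IH]]; [by right | by left; rewrite /= IH | ].
  have [/eqP E|E] := boolP (step (iter n step <[X]>%VS) == iter n step <[X]>%VS).
    by left; rewrite /= E.
  right; apply: leq_ltn_trans IH _ => /=; rewrite ltnNge.
  by apply: contraNN E => le; rewrite eq_sym eqEdim stepS.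
set W := iter _ _ _.
have sW : step W = W.
  have [//|le] := stab (\dim {:S2 L}).
  have -> : W = fullv by apply/eqP; rewrite eqEdim subvf.
  by apply/eqP; rewrite eqEsubv subvf stepS.
move=> x Y YW; rewrite (coord_vbasis (memvf x)) linear_sum sum_lfunE.
apply: memv_suml => i _; rewrite linearZ scale_lfunE memvZ //.
rewrite -sW; apply: subvP (addvSr _ _) _ _.
by apply: subvP (sumv_sup i _ (subvv _)) _ _ => //; apply: memv_img.
Qed.

Lemma s2gen_id X : X \in s2gen X.
Proof.
rewrite /s2gen; elim: (\dim {:S2 L}) => [|n IH] /=; first exact: memv_line.
exact: subvP (addvSl _ _) _ IH.
Qed.

Lemma s2gen_min X W : s2submodule W -> X \in W -> (s2gen X <= W)%VS.
Proof.
move=> sW XW; rewrite /s2gen; elim: (\dim {:S2 L}) => [|n IH] /=.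
  by rewrite -memvE.
rewrite subv_add IH /=; apply/subv_sumP => i _; apply/subvP => _ /memv_imgP[Y Yn ->].
exact/sW/(subvP IH).
Qed.

Hypothesis kC : forall x y, k x y = k y x.
Hypothesis k_lin : forall x, linear (k x : L -> K^o).

Let k_linP x a y z : k x (a *: y + z) = a * k x y + k x z.
Proof. exact: k_lin. Qed.

Lemma s2bulletE l1 l2 l3 l4 :
  s2bullet (smul l1 l2) (smul l3 l4) =
  4^-1 *: (k l1 l3 *: smul l2 l4 + k l1 l4 *: smul l2 l3 +
           k l2 l3 *: smul l1 l4 + k l2 l4 *: smul l1 l3).
Proof.
pose q l1 l2 l3 l4 : S2 L :=
  4^-1 *: (k l1 l3 *: smul l2 l4 + k l1 l4 *: smul l2 l3 +
           k l2 l3 *: smul l1 l4 + k l2 l4 *: smul l1 l3).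
rewrite -/(q l1 l2 l3 l4).
have q34 m1 m2 m3 m4 : q m1 m2 m3 m4 = q m1 m2 m4 m3.
  by rewrite /q [_ *: smul m2 m4 + _]addrC -!addrA [X in _ + (_ + X)]addrC.
have qT m1 m2 m3 m4 : q m1 m2 m3 m4 = q m3 m4 m1 m2.
  rewrite /q !(kC m3) !(kC m4) !(smulC m3) !(smulC m4).
  by rewrite -!addrA [X in _ = _ *: (_ + X)]addrCA.
have q_lin m1 m2 m3 : linear (q m1 m2 m3).
  move=> a u v; rewrite /q !k_linP !smul_is_linear.
  rewrite scalerA [a * _]mulrC -scalerA -scalerDr; congr (_ *: _).
  rewrite !scalerDl !scalerDr -!scalerA.
  rewrite ![k _ _ *: (a *: _)]scalerA ![k _ _ * a]mulrC -!scalerA.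
  set t1 := a *: _; set t2 := a *: _; set t3 := a *: _; set t4 := a *: _.
  by rewrite (addrACA t1) (addrACA (t1 + t2)) (addrACA (t1 + t2 + t3)).
rewrite /s2bullet (eq_sext (g := fun m1 m2 => q m1 m2 l3 l4)).
  rewrite (sext_smul (f := fun m1 m2 => q m1 m2 l3 l4)) // => [u a v w|u v].
    by rewrite !(qT u) q_lin.
  by rewrite qT q34 -qT.
by move=> m1 m2; rewrite (sext_smul (f := q m1 m2)).
Qed.

Lemma s2formE l1 l2 l3 l4 :
  s2form (smul l1 l2) (smul l3 l4) =
  2^-1 * (k l1 l3 * k l2 l4 + k l1 l4 * k l2 l3).
Proof.
pose q l1 l2 l3 l4 : K^o := 2^-1 * (k l1 l3 * k l2 l4 + k l1 l4 * k l2 l3).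
rewrite -[RHS]/(q l1 l2 l3 l4).
have q34 m1 m2 m3 m4 : q m1 m2 m3 m4 = q m1 m2 m4 m3.
  by rewrite /q [k m1 m3 * _ + _]addrC.
have qT m1 m2 m3 m4 : q m1 m2 m3 m4 = q m3 m4 m1 m2.
  by rewrite /q !(kC m3) !(kC m4) [k m1 m4 * _]mulrC.
have q_lin m1 m2 m3 : linear (q m1 m2 m3).
  move=> a u v; rewrite /q !k_linP /GRing.scale /=; ring.
rewrite /s2form (eq_sext (g := fun m1 m2 => q m1 m2 l3 l4)).
  rewrite (sext_smul (f := fun m1 m2 => q m1 m2 l3 l4)) // => [u a v w|u v].
    by rewrite !(qT u) q_lin.
  by rewrite qT q34 -qT.
by move=> m1 m2; rewrite (sext_smul (f := q m1 m2)).
Qed.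
End LieSymmetricSquare.

(* Dynkin diagrams in Bourbaki's labelling, with vertices numbered from 0. *)
Variant ade_label := TypeA | TypeD | TypeE.

Definition ade_rank (T : ade_label) (n : nat) : bool :=
  match T with
  | TypeA => 3 <= n
  | TypeD => 4 <= n
  | TypeE => n \in [:: 6; 7; 8]
  end%N.

Definition ade_edge (T : ade_label) (n i j : nat) : bool :=
  match T with
  | TypeA => i.+1 == j
  | TypeD => (i.+1 == j) && (j.+1 < n) || (i.+3 == n) && (j.+1 == n)
  | TypeE => (i, j) \in [:: (0, 2); (1, 3); (2, 3); (3, 4); (4, 5); (5, 6); (6, 7)]
  end%N.

Definition ade_cartan (T : ade_label) (n : nat) (i j : 'I_n) : int :=
  if i == j then 2 else
  if ade_edge T n i j || ade_edge T n j i then -1 else 0.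

Section Roots.
Variables (K : numFieldType) (L : lieAlgType K) (k : L -> L -> K).
Variable H : {vspace L}.
Local Notation h := (subvs_of H).
Implicit Types (a : h).

Definition cform (x y : h) : K := k (vsval x) (vsval y).

(* Roots are taken in H itself: its dual is identified with H by means of the *)
(* form, so that the functional attached to a is k(a, -).                     *)
Definition in_root_space a (x : L) :=
  forall y : h, lie (vsval y) x = cform a y *: x.

Definition is_root a := a != 0 /\ exists2 x, x != 0 & in_root_space a x.

Definition coroot a : h := (2 / cform a a) *: a.

Variable Phi : {fset h}.

Definition is_root_set := forall a, a \in Phi <-> is_root a.

Definition is_base n (s : n.-tuple h) :=
  [/\ {subset s <= Phi}, free s &
      forall a : Phi, exists c : 'I_n -> nat,
        val a = \sum_i tnth s i *+ c i \/ val a = - \sum_i tnth s i *+ c i].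

Definition has_type (T : ade_label) n (s : n.-tuple h) :=
  ade_rank T n /\
  forall i j, cform (tnth s i) (coroot (tnth s j)) = (ade_cartan T i j)%:~R.

Definition is_highest_root n (s : n.-tuple h) (w : Phi) :=
  forall a : Phi, exists c : 'I_n -> nat,
    val w - val a = \sum_i tnth s i *+ c i.

(* The root vectors of a Chevalley basis; the number p is the largest one for *)
(* which b - p a is a root.                                                   *)
Definition is_chevalley (e : Phi -> L) :=
  [/\ forall a : Phi, in_root_space (val a) (e a),
      forall a b : Phi, val b = - val a ->
        lie (e a) (e b) = vsval (coroot (val a)) &
      forall (a b g : Phi) (p : nat), val g = val a + val b ->
        val b - val a *+ p \in Phi ->
        (forall q, val b - val a *+ q \in Phi -> (q <= p)%N) ->
        lie (e a) (e b) = e g *+ p.+1 \/ lie (e a) (e b) = - (e g *+ p.+1)].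

Definition jmap a : 'End(h) := linfun (fun x => cform x (coroot a) *: coroot a).
Definition Jspace : {vspace 'End(h)} := <<[seq jmap a | a <- Phi]>>%VS.

Definition perp a : {vspace h} := orthv cform <[a]>%VS.

(* The direct sum of copies of the spaces a^perp, as a space of families. *)
Definition single (a : Phi) (x : h) : {ffun Phi -> h} :=
  [ffun b => if b == a then x else 0].
Definition Hspace : {vspace {ffun Phi -> h}} :=
  (\sum_(a : Phi) linfun (single a) @: perp (val a))%VS.

Definition Lambda0 : {fset h} :=
  [fset (p.1 + p.2)%R | p in (Phi `*` Phi)%fset & (cform p.1 p.2 == 0)%R]%fset.

Definition frakA : Type :=
  (subvs_of Jspace * subvs_of Hspace * {ffun Lambda0 -> K^o})%type.
HB.instance Definition _ := Vector.on frakA.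

Definition frakA_j (a : Phi) : frakA :=
  (vsproj Jspace (jmap (val a)), 0, 0).
Definition frakA_h (a : Phi) (x : h) : frakA :=
  (0, vsproj Hspace (single a (orthproj cform (perp (val a)) x)), 0).
Definition frakA_x (l : Lambda0) : frakA :=
  (0, 0, [ffun m => (m == l)%:R]).

Section Algebra.
Variables (e : Phi -> L) (w : Phi).

Definition calA : {vspace S2 L} :=
  orthv (s2form k) (s2gen (smul (e w) (e w))).
Definition bar : 'End(S2 L) := orthproj (s2form k) calA.
Definition calA_mul (X Y : S2 L) : S2 L := bar (s2bullet k X Y).

Definition is_theta (al be : Lambda0 -> Phi) (theta : 'Hom(frakA, S2 L)) :=
  [/\ lker theta = 0%VS, limg theta = calA,
      forall a : Phi, theta (frakA_j a) =
        bar (smul (vsval (coroot (val a))) (vsval (coroot (val a)))),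
      forall (a : Phi) (x : h), theta (frakA_h a x) = bar (smul (e a) (vsval x)) &
      forall l, theta (frakA_x l) = bar (smul (e (al l)) (e (be l)))].

Definition frakA_mul (theta : 'Hom(frakA, S2 L)) (u v : frakA) : frakA :=
  (theta^-1)%VF (calA_mul (theta u) (theta v)).
Definition frakA_form (theta : 'Hom(frakA, S2 L)) (u v : frakA) : K :=
  s2form k (theta u) (theta v).
End Algebra.
End Roots.

(* Main.v *)
(** The product satisfies [C • X = X] for the Casimir element [C], because
    expanding a vector in a basis and its dual basis gives
    [sum_i k(b_i, x) b_i^* = x]; the projection onto [calA] then fixes [X] when
    [X] lies in [calA].  To see that [C] itself lies in [calA], note that
    [B(C, x y) = k(x, y)], so that [B(C, -)] is an invariant functional: its
    kernel is a submodule, and it contains [e_w e_w] since [k(e_w, e_w) = 0]. *)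

Require Import Defs.
From HB Require Import structures.
From mathcomp Require Import all_boot all_order all_algebra finmap.
From mathcomp Require Import reals complex.
Set Implicit Arguments.
Unset Strict Implicit.
Unset Printing Implicit Defensive.
Import GRing.Theory Num.Theory.
Import passmx.
Local Open Scope ring_scope.

(** * Forms linear in the second argument *)

Section LinearForm.
Variables (K : fieldType) (V : vectType K) (k : V -> V -> K).
Hypothesis k_lin : forall x, linear (k x : V -> K^o).

Lemma form_sumr I (r : seq I) (F : I -> V) a x :
  k x (\sum_(i <- r) a i *: F i) = \sum_(i <- r) a i * k x (F i).
Proof.
rewrite -(linfunE (k_lin x)) linear_sum; apply: eq_bigr => i _.
by rewrite linearZ /= linfunE.
Qed.

Lemma form_oppr x y : k x (- y) = - k x y.
Proof. by rewrite -!(linfunE (k_lin x)) linearN. Qed.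
Lemma form_scaler a x y : k x (a *: y) = a * k x y.
Proof. by rewrite -!(linfunE (k_lin x)) linearZ. Qed.
End LinearForm.

(** Both sides contain the trace of [fgh]; the remaining traces, of [gfh] and [fhg], agree by
    cyclicity. *)
Lemma mxtrace_commutator (K : fieldType) (V : vectType K) (f g h : 'End(V)) :
  let tr u := \tr (mxof (vbasis {:V}) (vbasis {:V}) u) in
  tr (((f \o g)%VF - (g \o f)%VF) \o h)%VF =
  tr (f \o ((g \o h)%VF - (h \o g)%VF))%VF.
Proof.
rewrite /= comp_lfunDl comp_lfunDr comp_lfunNl comp_lfunNr.
rewrite !linearB /= !(mxof_comp _ _ (vbasisP fullv)) !mulmxA.
by congr (_ - _); rewrite mxtrace_mulC mulmxA.
Qed.

(** * Invariance of the Killing form *)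

Section Invariance.
Variables (K : fieldType) (L : lieAlgType K).
Implicit Types x y z : L.

Lemma lieNr x y : lie x (- y) = - lie x y.
Proof. by rewrite -!adE linearN. Qed.

Lemma ad_lie x y : ad (lie x y) = (ad x \o ad y)%VF - (ad y \o ad x)%VF.
Proof.
apply/lfunP => z; rewrite add_lfunE opp_lfunE !comp_lfunE !adE.
suff: lie (lie x y) z = lie x (lie y z) - lie y (lie x z) by [].
rewrite (lieC (lie x y)) (lieC x z) lieNr (opprK (lie y _)).
by have /eqP := lie_jacobi x y z; rewrite addr_eq0 => /eqP->.
Qed.

Lemma killing_lie x y z : killing (lie x y) z = killing x (lie y z).
Proof. by rewrite /killing !ad_lie mxtrace_commutator. Qed.

(** In this shape of invariance, the two terms of the derivation action [s2act] cancel after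
    contraction. *)
Lemma kappa_lie c x y z : kappa c (lie x y) z = - kappa c y (lie x z).
Proof.
rewrite (lieC x y) kappaC (form_oppr (kappa_is_linear c)) kappaC.
by rewrite /kappa killing_lie.
Qed.
End Invariance.

(** * Generation of the symmetric square by products; dual bases *)

Section SymmetricSquare.
Variables (K : numFieldType) (V : vectType K).

Lemma smul_suml I (r : seq I) (a : I -> K) (F : I -> V) y :
  smul (\sum_(i <- r) a i *: F i) y = \sum_(i <- r) a i *: smul (F i) y.
Proof.
rewrite smulC -(linfunE (smul_is_linear y)) linear_sum.
apply: eq_bigr => i _.
by rewrite linearZ /= (linfunE (smul_is_linear y)) smulC.
Qed.

(** Tensors of basis vectors are matrix units, and a symmetric matrix is half the sum of itself and
    its transpose. *)
Lemma S2_span (X : S2 V) :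
  X = \sum_i \sum_j vsval X i j *: smul (vbasis {:V})`_i (vbasis {:V})`_j.
Proof.
have sX : (vsval X)^T = vsval X.
  by have /fixedSpaceP := subvsP X; rewrite lfunE.
have tE (i j : 'I_(\dim {:V})) :
    tens (vbasis {:V})`_i (vbasis {:V})`_j = delta_mx i j.
  by rewrite /tens !(rVofE (vbasisP fullv)) trmx_delta mul_delta_mx.
apply: val_inj; rewrite /= linear_sum /=.
transitivity (2^-1 *: (vsval X + (vsval X)^T)).
  by rewrite sX -mulr2n -scaler_nat scalerA mulVf ?pnatr_eq0 ?scale1r.
rewrite [Z in _ *: (_ + Z^T)]matrix_sum_delta.
rewrite [Z in _ *: (Z + _)]matrix_sum_delta.
rewrite linear_sum -big_split scaler_sumr; apply: eq_bigr => i _ /=.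
rewrite !linear_sum -big_split scaler_sumr; apply: eq_bigr => j _ /=.
rewrite val_smul !tE linearZ /= trmx_delta -scalerDr.
by rewrite !scalerA mulrC.
Qed.

(** Reduces identities linear in [X] to products [smul u v], on which the product and the form are
    explicit. *)
Lemma S2_ind (P : S2 V -> Prop) :
  (forall a X Y, P X -> P Y -> P (a *: X + Y)) ->
  (forall u v, P (smul u v)) -> forall X, P X.
Proof.
move=> Plin Psmul X; rewrite (S2_span X).
(* Zero is obtained as [-1 *: smul 0 0 + smul 0 0]. *)
have P0 : P 0 by rewrite -(addNr (smul 0 0)) -scaleN1r; apply: Plin.
have Psum I (F : I -> S2 V) (r : seq I) :
    (forall i, P (F i)) -> P (\sum_(i <- r) F i).
  move=> PF; apply: big_ind => // Y Z PY PZ.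
  by rewrite -[Y]scale1r; apply: Plin.
apply: (Psum) => i; apply: (Psum) => j.
by rewrite -[_ *: _]addr0; apply: Plin.
Qed.

Lemma sext2_is_linear (W : lmodType K) (F : V -> V -> V -> V -> W) X :
  linear (fun Y => sext (fun u v => sext (F u v) Y) X).
Proof.
(* Only the outer extensions are unfolded; the inner ones stay linear maps in their tensor
   argument. *)
move=> a Y Z; rewrite {1 3 5}/sext scaler_sumr -big_split.
apply: eq_bigr => i _ /=; rewrite scaler_sumr -big_split.
by apply: eq_bigr => j _ /=; rewrite linearP scalerDr !scalerA mulrC.
Qed.

Section DualBases.
Variables (k : V -> V -> K) (b bd : (\dim {:V}).-tuple V).
Hypothesis kC : forall x y, k x y = k y x.
Hypothesis k_lin : forall x, linear (k x : V -> K^o).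
Hypothesis b_basis : basis_of {:V} b.
Hypothesis b_dual : forall i j, k (tnth b i) (tnth bd j) = (i == j)%:R.

Lemma dual_basis_expand x : \sum_i k (tnth bd i) x *: tnth b i = x.
Proof.
rewrite [x in RHS](coord_basis b_basis (memvf x)); apply: eq_bigr => i _.
rewrite {1}(coord_basis b_basis (memvf x)) (form_sumr k_lin) (bigD1 i) //=.
rewrite -!tnth_nth kC b_dual eqxx mulr1 big1 ?addr0 // => j ji.
by rewrite -tnth_nth kC b_dual (negPf ji) mulr0.
Qed.

(** Pairing a vanishing combination of the [bd] with the i-th vector of [b] isolates its i-th
    coefficient; the length of [bd] does the rest. *)
Lemma dual_basis : basis_of {:V} bd.
Proof.
rewrite basisEfree subvf size_tuple leqnn !andbT.
apply/freeP => a a0 i.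
have := form_sumr k_lin (index_enum _) (tnth bd) a (tnth b i).
under eq_bigr do rewrite (tnth_nth 0).
rewrite a0 (bigD1 i) //= b_dual eqxx mulr1 big1 ?addr0 => [|j ji].
  by rewrite -(linfunE (k_lin _)) linear0 => <-.
by rewrite b_dual eq_sym (negPf ji) mulr0.
Qed.
End DualBases.
End SymmetricSquare.

(** * Product, form and contraction on the symmetric square *)

Section LieSymmetricSquare.
Variables (K : numFieldType) (L : lieAlgType K) (k : L -> L -> K).
Hypothesis kC : forall x y, k x y = k y x.
Hypothesis k_lin : forall x, linear (k x : L -> K^o).

(** This is the functional B(C, -) attached to the Casimir element C, by [s2form_casimir]. *)
Definition s2contract : S2 L -> K^o := sext (k : L -> L -> K^o).
HB.instance Definition _ := GRing.Linear.on s2contract.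

Lemma s2contract_linear : linear s2contract.
Proof. exact: linearP. Qed.

Lemma s2contractD X Y : s2contract (X + Y) = s2contract X + s2contract Y.
Proof. exact: linearD. Qed.

Lemma s2contract_smul x y : s2contract (smul x y) = k x y.
Proof. exact: sext_smul. Qed.

Lemma s2bullet_linearr X : linear (s2bullet k X).
Proof. exact: sext2_is_linear. Qed.

Lemma s2form_linearr X : linear (s2form k X : S2 L -> K^o).
Proof. exact: sext2_is_linear. Qed.

Lemma s2bullet_suml I (r : seq I) (F : I -> S2 L) Y :
  s2bullet k (\sum_(i <- r) F i) Y = \sum_(i <- r) s2bullet k (F i) Y.
Proof. by rewrite /s2bullet linear_sum. Qed.

Lemma s2form_linearl Y : linear (s2form k ^~ Y : S2 L -> K^o).
Proof. by move=> a X Z; apply: linearP. Qed.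

Lemma s2bulletC X Y : s2bullet k X Y = s2bullet k Y X.
Proof.
have linl Z : linear (s2bullet k ^~ Z) by move=> a X' Y'; apply: linearP.
elim/S2_ind: X => [a X Z XY ZY|x1 x2].
  by rewrite linl s2bullet_linearr XY ZY.
elim/S2_ind: Y => [a X Z XY ZY|y1 y2].
  by rewrite linl s2bullet_linearr XY ZY.
rewrite !s2bulletE // !(kC y1) !(kC y2) !(smulC y1) !(smulC y2).
by rewrite -!addrA [X in _ = _ *: (_ + X)]addrCA.
Qed.

Lemma s2form_suml I (r : seq I) (F : I -> S2 L) Y :
  s2form k (\sum_(i <- r) F i) Y = \sum_(i <- r) s2form k (F i) Y.
Proof. by rewrite /s2form linear_sum. Qed.

Lemma s2formC X Y : s2form k X Y = s2form k Y X.
Proof.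
elim/S2_ind: X => [a X Z XY ZY|x1 x2].
  by rewrite s2form_linearl s2form_linearr XY ZY.
elim/S2_ind: Y => [a X Z XY ZY|y1 y2].
  by rewrite s2form_linearl s2form_linearr XY ZY.
by rewrite !s2formE // !(kC y1) !(kC y2) [k x1 y2 * _]mulrC.
Qed.

(** * The Casimir element *)

Section Casimir.
Variables b bd : (\dim {:L}).-tuple L.
Hypothesis b_basis : basis_of {:L} b.
Hypothesis b_dual : forall i j, k (tnth b i) (tnth bd j) = (i == j)%:R.

Let b_sum x : \sum_i k (tnth bd i) x *: tnth b i = x.
Proof. exact: dual_basis_expand. Qed.

Let bd_sum x : \sum_i k (tnth b i) x *: tnth bd i = x.
Proof.
(* The two bases exchange roles: [b] is dual to [bd] since [k] is symmetric. *)
apply: dual_basis_expand => //; first exact: dual_basis b_dual.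
by move=> i j; rewrite kC b_dual eq_sym.
Qed.

Lemma s2bullet_casimir X : s2bullet k (casimir b bd) X = X.
Proof.
elim/S2_ind: X => [a X Y XE YE|x y]; first by rewrite s2bullet_linearr XE YE.
rewrite s2bullet_suml.
under eq_bigr do rewrite s2bulletE //.
(* Each of the four sums collapses to [smul x y], which cancels the factor 1/4. *)
rewrite -scaler_sumr !big_split /= -!smul_suml !b_sum !bd_sum (smulC y).
rewrite -!mulr2n -!mulrSr -scaler_nat scalerA.
by rewrite mulVf ?pnatr_eq0 ?scale1r.
Qed.

Lemma s2form_casimir X : s2form k (casimir b bd) X = s2contract X.
Proof.
elim/S2_ind: X => [a X Y XE YE|x y].
  by rewrite s2form_linearr XE YE linearP.
rewrite s2contract_smul s2form_suml.
under eq_bigr do rewrite s2formE //.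
rewrite -mulr_sumr big_split /=.
(* Symmetry moves each [bd] vector into the second argument, where [form_sumr] gathers the sum into
   the expansion of [x] or [y]. *)
under [X in _ + X]eq_bigr do rewrite (kC _ x).
under eq_bigr do rewrite (kC _ y).
rewrite -!(form_sumr k_lin) !bd_sum (kC y) -mulr2n.
by rewrite -(mulr_natl (k x y)) mulrA mulVf ?pnatr_eq0 ?mul1r.
Qed.
End Casimir.

Hypothesis k_inv : forall x y z, k (lie x y) z = - k y (lie x z).

Lemma s2contract_s2act x X : s2contract (s2act x X) = 0.
Proof.
elim/S2_ind: X => [a X Y XE YE|y z].
  by rewrite linearP s2contract_linear XE YE scaler0 addr0.
by rewrite s2actE s2contractD !s2contract_smul k_inv addNr.
Qed.

Lemma casimir_calA (H : {vspace L}) (Phi : {fset subvs_of H}) (e : Phi -> L)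
    (w : Phi) (b bd : (\dim {:L}).-tuple L) :
  basis_of {:L} b ->
  (forall i j, k (tnth b i) (tnth bd j) = (i == j)%:R) ->
  k (e w) (e w) = 0 -> casimir b bd \in calA k e w.
Proof.
move=> b_basis b_dual kew; apply/(orthvP s2formC s2form_linearr) => X.
(* The contraction kills every [s2act x Y], so its kernel is a submodule. *)
have: (s2gen (smul (e w) (e w)) <= lker (linfun s2contract))%VS.
  apply: s2gen_min => [x Y _|]; rewrite memv_ker lfunE /=.
    by rewrite s2contract_s2act.
  by rewrite s2contract_smul kew.
move/subvP/[apply]; rewrite memv_ker lfunE /= => /eqP tX.
by rewrite s2formC s2form_casimir.
Qed.

(** Since [a] acts on [x] by the scalar k(a, a), invariance makes k(a, a) k(x, x) equal to its own
    negative. *)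
Lemma root_vector_isotropic (H : {vspace L}) (a : subvs_of H) x :
  cform k a a != 0 -> in_root_space k a x -> k x x = 0.
Proof.
move=> aa0 /(_ a) ax; have := k_inv (vsval a) x x.
rewrite ax kC (form_scaler k_lin) => /eqP.
by rewrite eq_sym eqNr mulf_eq0 (negPf aa0) => /eqP.
Qed.
End LieSymmetricSquare.

(** * Transport of the unit along [theta] *)

Lemma casimir_unit (K : numFieldType) (L : lieAlgType K) (H : {vspace L})
    (c : K) (Phi : {fset subvs_of H}) (e : Phi -> L) (w : Phi)
    (theta : 'Hom(frakA (kappa c) Phi, S2 L)) (b bd : (\dim {:L}).-tuple L) :
  cform (kappa c) (coroot (kappa c) (val w)) (coroot (kappa c) (val w)) != 0 ->
  in_root_space (kappa c) (val w) (e w) ->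
  lker theta = 0%VS -> limg theta = calA (kappa c) e w ->
  basis_of {:L} b ->
  (forall i j, kappa c (tnth b i) (tnth bd j) = (i == j)%:R) ->
  let one := (theta^-1)%VF (casimir b bd) in
  forall a : frakA (kappa c) Phi,
    frakA_mul e w theta one a = a /\ frakA_mul e w theta a one = a.
Proof.
move=> coroot_n0 e_root ker0 img b_basis b_dual.
have kC := @kappaC _ L c; have k_lin := @kappa_is_linear _ L c.
have k_inv := @kappa_lie _ L c.
have ww0 : cform (kappa c) (val w) (val w) != 0.
  (* If k(w, w) were 0, the convention that 0 has inverse 0 would make the coroot zero. *)
  apply: contra_neq coroot_n0 => ww0.
  rewrite /coroot ww0 invr0 mulr0 scale0r /cform linear0.
  by rewrite -[X in kappa c _ X](scale0r 0) (form_scaler k_lin) mul0r.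
have kew := root_vector_isotropic kC k_lin k_inv ww0 e_root.
have CA := casimir_calA kC k_lin k_inv b_basis b_dual kew.
move=> one a.
(* The inverse of [theta] is a section only over its image [calA], which contains the Casimir
   element by [CA]. *)
have thetaone : theta one = casimir b bd by rewrite limg_lfunVK // img.
have thetaK : cancel theta (theta^-1)%VF by apply/lker0_lfunK/eqP.
have barE : bar (kappa c) e w (theta a) = theta a.
  by apply: addv_pi2_id; rewrite -img memv_img ?memvf.
rewrite /frakA_mul /calA_mul thetaone.
rewrite [s2bullet _ (theta a) _](s2bulletC kC k_lin).
by rewrite (s2bullet_casimir kC k_lin b_basis b_dual) barE thetaK.
Qed.

Theorem theorem5p5 (R : realType) (L : lieAlgType R[i]) (H : {vspace L})
    (c : R[i]) (Phi : {fset subvs_of H}) (e : Phi -> L)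
    (T : ade_label) (n : nat) (s : n.-tuple (subvs_of H)) (w : Phi)
    (al be : Lambda0 (kappa c) Phi -> Phi)
    (theta : 'Hom(frakA (kappa c) Phi, S2 L))
    (b bd : (\dim {:L}).-tuple L) :
  is_simple L -> is_cartan H -> is_root_set (kappa c) Phi ->
  (forall a : Phi,
     cform (kappa c) (coroot (kappa c) (val a)) (coroot (kappa c) (val a)) = 2) ->
  is_base Phi s -> has_type (kappa c) T s ->
  is_highest_root s w -> is_chevalley (kappa c) e ->
  (forall l, val (al l) + val (be l) = val l) ->
  is_theta e w al be theta ->
  basis_of {:L} b ->
  (forall i j, kappa c (tnth b i) (tnth bd j) = (i == j)%:R) ->
  let one := (theta^-1)%VF (casimir b bd) in
  forall a : frakA (kappa c) Phi,
    frakA_mul e w theta one a = a /\ frakA_mul e w theta a one = a.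
Proof.
move=> _ _ _ coroot2 _ _ _ [e_root _ _] _ [ker0 img _ _ _].
apply: casimir_unit => //.
by rewrite coroot2 pnatr_eq0.
Qed.
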